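(* Let $(\bar x,\bar u)$ be a weak local minimizer of problem (P) such that, for some $\delta_0\in(0,1)$, $$\int_{1-\delta}^1\frac{dt}{|\bar g_u(t)|}=\infty\qquad\text{for every }\delta\in(0,\delta_0],$$ with the convention $1/0=+\infty$, and suppose that each entry of $\bar f_u$, $\bar L_u$ and $\bar g_x$ admits an essential limit at $t=1$ (denoted $\bar f_u(1)$, $\bar L_u(1)$, $\bar g_x(1)$). Let $(\lambda,\beta,\lambda_0,z,\zeta)$ be any multiplier tuple for (P) at $(\bar x,\bar u)$, and set $$\zeta_1:=\lim_{t\to1^-}\zeta\bigl((t,1]\bigr)\in\bigl[0,\zeta([0,1])\bigr].$$ Then the costate has left limit $\lambda(1^-)=\zeta_1\,\bar g_x(1)^T$, and the terminal balance identity $$\lambda_0\,\bar L_u(1)^T+\zeta_1\,\bar f_u(1)^T\bar g_x(1)^T=0$$ holds. In particular: (i) if $\bar L_u(1)\ne0$ and $\bar L_u(1)^T\ne-c\,\bar f_u(1)^T\bar g_x(1)^T$ for every $c>0$, then $\lambda_0=0$; if moreover $\bar f_u(1)^T\bar g_x(1)^T\ne0$, then also $\zeta_1=0$; (ii) if $\bar L_u(1)^T=-c_0\,\bar f_u(1)^T\bar g_x(1)^T$ for some $c_0>0$ and $\bar f_u(1)^T\bar g_x(1)^T\neq0$, then $\zeta_1=c_0\lambda_0$: every normal tuple (i.e. with $\lambda_0>0$) carries a pure charge placing mass at least $c_0\lambda_0>0$ on every interval $(1-\varepsilon,1)$, $\varepsilon>0$.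
   Context: Notation. $|\cdot|$ is the Euclidean norm; ''a.e.'' refers to Lebesgue measure $\mathrm{Leb}$; $\mathfrak L$ is the $\sigma$-algebra of Lebesgue measurable subsets of $[0,1]$. $BV([0,1];\mathbb R^n)$ denotes functions of bounded variation that are right-continuous on $(0,1)$. A measurable $k:[0,1]\to\mathbb R$ has essential limit $\alpha$ at $t$ if for every $\varepsilon>0$ there is a neighborhood $V$ of $t$ with $|k(s)-\alpha|<\varepsilon$ for a.e. $s\in V\cap[0,1]$; for $k$ in a Lebesgue space, ''$k(t)$'' at a given instant $t$ denotes its essential limit there. Problem (P): minimize $J(x,u)=\int_0^1L(t,x(t),u(t))\,dt$ over $(x,u)\in W^{1,1}([0,1];\mathbb R^n)\times L^\infty([0,1];\mathbb R^m)$ subject to $\dot x(t)=f(t,x(t),u(t))$ a.e., $g(t,x(t),u(t))\le 0$ a.e., $x(0)=x_0$, where $x_0\in\mathbb R^n$ is fixed and $(L,f,g):[0,1]\times\mathbb R^n\times\mathbb R^m\to\mathbb R\times\mathbb R^n\times\mathbb R$ are continuous in $(t,x,u)$ and continuously differentiable in $(x,u)$ (derivatives jointly continuous in $(t,x,u)$). Pairs satisfying the constraints are admissible processes. A weak local minimizer is an admissible $(\bar x,\bar u)$ for which there is $\varepsilon>0$ with $J(\bar x,\bar u)\le J(x,u)$ for all admissible $(x,u)$ with $\|x-\bar x\|_C<\varepsilon$, $\|u-\bar u\|_{L^\infty}<\varepsilon$. A bar denotes evaluation along $(\bar x,\bar u)$: $\bar k(t)=k(t,\bar x(t),\bar u(t))$;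 $\bar L_x,\bar L_u,\bar g_x,\bar g_u$ are row vectors and $\bar f_x,\bar f_u$ Jacobian matrices. Charges. A charge is a finitely additive set function on $\mathfrak L$ vanishing at $\emptyset$; $\operatorname{ba}$ denotes the bounded charges vanishing on Lebesgue null sets (isometric to $L^\infty([0,1];\mathbb R)^*$ with the total variation norm). A positive charge $\zeta$ is pure if the only countably additive measure $\mu$ with $0\le\mu\le\zeta$ is $\mu=0$. For $k\in L^\infty$, $\int_E k\,d\zeta$ is the limit of integrals of simple functions converging to $k\chi_E$ uniformly a.e. (componentwise for vectors). For $\zeta\ge0$, ''$k=0$ $\zeta$-a.e.'' means $\zeta(\{|k|>\varepsilon\})=0$ for all $\varepsilon>0$. Multiplier tuple for (P) at $(\bar x,\bar u)$: $(\lambda,\beta,\lambda_0,z,\zeta)$ with $\lambda_0\ge0$ a scalar, $z\in L^1([0,1];\mathbb R)$, $z\ge0$, $\zeta\in\operatorname{ba}$ a pure charge, $\zeta\ge0$, $\lambda,\beta\in BV([0,1];\mathbb R^n)$ such that: (a) $\lambda_0+\|z\|_{L^1}+\zeta([0,1])>0$; (b) $z(t)\bar g(t)=0$ a.e. and $\bar g=0$ $\zeta$-a.e.; (c) $\lambda(1)=\beta(1)=0$, $-d\lambda=[\bar f_x^T\lambda+\lambda_0\bar L_x^T+z\bar g_x^T]\,dt+d\beta$ (as measures on $[0,1]$), where $\beta(0)=-\int_0^1\bar g_x^T\,d\zeta$ and $\beta(t)=-\lim_{k\to\infty}\int_{t+1/k}^1\bar g_x^T\,d\zeta$ for $t\in(0,1)$;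 (d) $0=\bar f_u^T\lambda+\lambda_0\bar L_u^T+\bar g_u^Tz$ a.e., and $\int_E\bar g_u^T\,d\zeta=0$ for every $E\in\mathfrak L$. *)

(* Defs.v *)
From HB Require Import structures.
From mathcomp Require Import all_boot all_order all_algebra.
From mathcomp Require Import all_classical all_reals all_analysis.

Set Implicit Arguments.
Unset Strict Implicit.
Unset Printing Implicit Defensive.
Import Order.TTheory GRing.Theory Num.Theory.
Import numFieldNormedType.Exports.

Local Open Scope classical_set_scope.
Local Open Scope ring_scope.

(* The real line with the sigma-algebra of Lebesgue (not only Borel)
   measurable sets. *)
Definition lebR (R : realType) : measurableType _ :=
  caratheodory_type (@wlength R idfun)^*%mu.

Definition Leb {R : realType} : {measure set (lebR R) -> \bar R} :=
  @completed_lebesgue_measure R.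

Definition I01 {R : realType} : set (lebR R) := `[0%R, 1%R]%classic.

Definition ae01 {R : realType} (P : R -> Prop) : Prop :=
  {ae @Leb R, forall t, I01 t -> P t}.

(* Euclidean norm of a row or column vector; the library norm on matrices is
   the sup norm, which only induces the same topology. *)
Definition enorm {R : realType} {p q : nat} (A : 'M[R]_(p, q)) : R :=
  Num.sqrt (\sum_i \sum_j A i j ^+ 2).

(* Functions of time are total on the line; only their values on [0,1] are
   used. *)

(* W^{1,1}([0,1]; R^n), as the space of absolutely continuous functions *)
Definition abs_continuous {R : realType} {n : nat} (x : R -> 'cV[R]_n) : Prop :=
  forall e : R, 0 < e -> exists2 d : R, 0 < d &
    forall (k : nat) (a b : 'I_k -> R),
      (forall i, [/\ 0 <= a i, a i <= b i & b i <= 1]) ->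
      trivIset setT (fun i => `]a i, b i[%classic) ->
      \sum_(i < k) (b i - a i) < d ->
      \sum_(i < k) enorm (x (b i) - x (a i)) < e.

Definition norm_C {R : realType} {n : nat} (x : R -> 'cV[R]_n) : \bar R :=
  ereal_sup [set (enorm (x t))%:E | t in `[0, 1]].

Definition norm_Linfty {R : realType} {m : nat} (u : R -> 'cV[R]_m) : \bar R :=
  ('N[@Leb R]_+oo [ (fun t : lebR R => (enorm (u t))%:E) \_ I01 ])%E.

Definition Linfty {R : realType} {m : nat} (u : R -> 'cV[R]_m) : Prop :=
  (forall j, measurable_fun (@I01 R) (fun t : lebR R => u t j 0)) /\
  (norm_Linfty u < +oo)%E.

Definition norm_L1 {R : realType} (z : R -> R) : \bar R :=
  ('N[@Leb R]_1 [ (fun t : lebR R => (z t)%:E) \_ I01 ])%E.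

Definition BVr {R : realType} {n : nat} (h : R -> 'cV[R]_n) : Prop :=
  (forall i, bounded_variation 0 1 (fun t => h t i 0)) /\
  (forall t, 0 < t < 1 -> h s @[s --> t^'+] --> h t).

(* [nu] agrees with dh on the Borel subsets of [0,1]. The intervals [0,t] with
   0 < t <= 1 generate the Borel sets of [0,1]; in particular
   nu {0} = h(0+) - h(0) and nu {1} = h(1) - h(1-). *)
Definition is_differential {R : realType} (h : R -> R)
    (nu : {charge set (measurableTypeR R) -> \bar R}) : Prop :=
  forall t : R, 0 < t <= 1 -> nu `[0%R, t]%classic = (h t - h 0)%:E.

Definition ess_limit {R : realType} (k : R -> R) (t alpha : R) : Prop :=
  forall e : R, 0 < e ->
    exists2 V, nbhs t V & ae01 (fun s => V s -> `|k s - alpha| < e).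

(* The library's [additive_charge] is finitely
    additive ([charge] is countably additive). A charge on [0,1] is represented
    by its extension by 0 to the line. *)

Import HBSimple.

Section ba.
Context {R : realType}.
Implicit Type zeta : {additive_charge set (lebR R) -> \bar R}.

Definition ba zeta : Prop :=
  (exists M : R, forall A : set (lebR R),
     measurable A -> (`|zeta A| <= M%:E)%E) /\
  (forall A : set (lebR R), measurable A ->
     Leb (A `&` I01) = 0%E -> zeta A = 0%E).

Definition nonneg_charge zeta : Prop :=
  forall A : set (lebR R), measurable A -> (0 <= zeta A)%E.

Definition pure zeta : Prop :=
  forall mu : {measure set (lebR R) -> \bar R},
    (forall A : set (lebR R), measurable A -> (mu A <= zeta A)%E) ->
    forall A : set (lebR R), measurable A -> mu A = 0%E.

(* v is the integral of k over E with respect to zeta: the limit of the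
   integrals of simple functions converging to k \1_E uniformly a.e. *)
Definition is_charge_integral zeta (E : set R) (k : R -> R) (v : R) : Prop :=
  exists s : nat -> {sfun lebR R >-> R},
    (forall e : R, 0 < e -> \forall j \near \oo,
       ae01 (fun t => `|s j t - (k \_ E) t| < e)) /\
    sintegral zeta (s j) @[j --> \oo] --> v%:E.

Definition zero_charge_ae zeta (k : R -> R) : Prop :=
  forall e : R, 0 < e -> zeta [set t : lebR R | I01 t /\ e < `|k t|] = 0%E.

Definition tail_mass zeta (t : R) : R := fine (zeta `]t, 1%R]%classic).

Definition terminal_mass zeta : R := lim (tail_mass zeta t @[t --> 1^'-]).

End ba.

Definition Jac {R : realType} {p q : nat}
    (F : 'cV[R]_p -> 'cV[R]_q) (y : 'cV[R]_p) : 'M[R]_(q, p) :=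
  \matrix_(i, j) ('D_(delta_mx j 0) F y) i 0.

Definition rgrad {R : realType} {p : nat}
    (F : 'cV[R]_p -> R) (y : 'cV[R]_p) : 'rV[R]_p :=
  \row_j 'D_(delta_mx j 0) F y.

Definition continuous_txu {R : realType} {n m : nat} {W : topologicalType}
    (k : R -> 'cV[R]_n -> 'cV[R]_m -> W) : Prop :=
  {within [set p : R * 'cV[R]_n * 'cV[R]_m | 0 <= p.1.1 <= 1],
    continuous (fun p => k p.1.1 p.1.2 p.2)}.

Definition C1_xu {R : realType} {n m : nat} {W : normedModType R}
    (k : R -> 'cV[R]_n -> 'cV[R]_m -> W) : Prop :=
  [/\ continuous_txu k,
      forall t x u, 0 <= t <= 1 ->
        differentiable (fun p : 'cV[R]_n * 'cV[R]_m => k t p.1 p.2) (x, u),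
      forall j, continuous_txu
        (fun t x u => 'D_(delta_mx j 0) (fun y => k t y u) x) &
      forall j, continuous_txu
        (fun t x u => 'D_(delta_mx j 0) (fun v => k t x v) u)].

Record problem (R : realType) (n m : nat) := Problem {
  cost : R -> 'cV[R]_n -> 'cV[R]_m -> R;
  dyn : R -> 'cV[R]_n -> 'cV[R]_m -> 'cV[R]_n;
  constr : R -> 'cV[R]_n -> 'cV[R]_m -> R;
  x_init : 'cV[R]_n;
  cost_C1 : C1_xu cost;
  dyn_C1 : C1_xu dyn;
  constr_C1 : C1_xu constr
}.

Section problem.
Context {R : realType} {n m : nat} (P : problem R n m).
Local Notation L := (cost P).
Local Notation f := (dyn P).
Local Notation g := (constr P).

Section along.
Variables (x : R -> 'cV[R]_n) (u : R -> 'cV[R]_m).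

Definition J : R := \int[@Leb R]_(t in I01) L t (x t) (u t).

Definition admissible : Prop :=
  [/\ abs_continuous x /\ Linfty u,
      ae01 (fun t => is_derive t 1 x (f t (x t) (u t))),
      ae01 (fun t => g t (x t) (u t) <= 0) &
      x 0 = x_init P].

Definition gbar (t : R) : R := g t (x t) (u t).
Definition Lx (t : R) : 'rV[R]_n := rgrad (fun y => L t y (u t)) (x t).
Definition Lu (t : R) : 'rV[R]_m := rgrad (fun v => L t (x t) v) (u t).
Definition fx (t : R) : 'M[R]_n := Jac (fun y => f t y (u t)) (x t).
Definition fu (t : R) : 'M[R]_(n, m) := Jac (fun v => f t (x t) v) (u t).
Definition gx (t : R) : 'rV[R]_n := rgrad (fun y => g t y (u t)) (x t).
Definition gu (t : R) : 'rV[R]_m := rgrad (fun v => g t (x t) v) (u t).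

(* -dlam = [fx^T lam + lam0 Lx^T + z gx^T] dt + dbeta as measures on [0,1] *)
Definition costate_equation (lam beta : R -> 'cV[R]_n) (lam0 : R) (z : R -> R)
    : Prop :=
  forall i : 'I_n,
  exists dlam dbeta : {charge set (measurableTypeR R) -> \bar R},
    [/\ is_differential (fun t => lam t i 0) dlam,
        is_differential (fun t => beta t i 0) dbeta &
        forall A : set (measurableTypeR R), measurable A -> A `<=` `[0, 1] ->
          (- dlam A =
           (\int[@Leb R]_(t in A)
             (((fx t)^T *m lam t + lam0 *: (Lx t)^T + z t *: (gx t)^T) i 0)%:E)
           + dbeta A)%E].

Record multiplier_tuple (lam beta : R -> 'cV[R]_n) (lam0 : R) (z : R -> R)
    (zeta : {additive_charge set (lebR R) -> \bar R}) : Prop :=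
  MultiplierTuple {
    lam0_ge0 : 0 <= lam0;
    z_L1 : (@Leb R).-integrable I01 (fun t : lebR R => (z t)%:E);
    z_ge0 : ae01 (fun t => 0 <= z t);
    zeta_ba : ba zeta;
    zeta_ge0 : nonneg_charge zeta;
    zeta_pure : pure zeta;
    lam_BV : BVr lam;
    beta_BV : BVr beta;
    mt_nontriv : (0 < lam0%:E + norm_L1 z + zeta I01)%E;
    mt_slack_z : ae01 (fun t => z t * gbar t = 0);
    mt_slack_zeta : zero_charge_ae zeta gbar;
    lam_at1 : lam 1 = 0;
    beta_at1 : beta 1 = 0;
    mt_costate : costate_equation lam beta lam0 z;
    beta_at0 : forall i,
      is_charge_integral zeta I01 (fun t => gx t 0 i) (- beta 0 i 0);
    beta_inside : forall t : R, 0 < t < 1 -> forall i,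
      exists2 I : nat -> R,
        forall k, is_charge_integral zeta `[t + k.+1%:R^-1, 1]
                    (fun s => gx s 0 i) (I k) &
        I k @[k --> \oo] --> - beta t i 0;
    mt_stationary : ae01 (fun t =>
      (fu t)^T *m lam t + lam0 *: (Lu t)^T + z t *: (gu t)^T = 0);
    mt_gu_zeta : forall E : set (lebR R), measurable E -> E `<=` I01 ->
      forall j, is_charge_integral zeta E (fun t => gu t 0 j) 0
  }.

End along.

Definition weak_local_minimizer (xb : R -> 'cV[R]_n) (ub : R -> 'cV[R]_m)
    : Prop :=
  admissible xb ub /\
  exists2 e : R, 0 < e & forall x u, admissible x u ->
    (norm_C (fun t => x t - xb t)%R < e%:E)%E ->
    (norm_Linfty (fun t => u t - ub t)%R < e%:E)%E ->
    J xb ub <= J x u.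

End problem.

(* Main.v *)
(** Let [zeta1] be the mass that [zeta] concentrates at the end point. Near [1]
    the weight [gx] is essentially constant, so the charge integrals defining
    [beta] give [beta(1-) = - zeta1 gx1^T]. The measures [- dlam] and [dbeta]
    differ by an absolutely continuous one, so [dlam + dbeta] has no atom at [1]:
    [lam + beta] has left limit [lam(1) + beta(1) = 0], whence
    [lam(1-) = zeta1 gx1^T]. By stationarity [|fu^T lam + lam0 Lu^T|] is at most
    [z |gu|]; if its essential limit at [1] were not zero, [1 / |gu|] would be
    bounded near [1] by a multiple of the integrable [z], against the divergence
    of its integral. *)
Require Import Defs.
From HB Require Import structures.
From mathcomp Require Import all_boot all_order all_algebra.
From mathcomp Require Import finmap.
From mathcomp Require Import ring lra.
From mathcomp Require Import all_classical all_reals all_analysis.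
From mathcomp Require Import measurable_realfun.
Set Implicit Arguments.
Unset Strict Implicit.
Unset Printing Implicit Defensive.
Import Order.TTheory GRing.Theory Num.Theory.
Import numFieldNormedType.Exports.
Local Open Scope classical_set_scope.
Local Open Scope ring_scope.

(** * Finite additivity of charges and level sets *)

Section additive_charge.
Context d (T : measurableType d) (R : realType).
Variable zeta : {additive_charge set T -> \bar R}.
Implicit Types A B : set T.

Lemma additive_charge0 : zeta set0 = 0%E.
Proof.
have /[!big_ord0] ->// := @charge_semi_additive _ _ _ zeta (fun=> set0) 0%N.
exact: trivIset_set0.
Qed.

Lemma additive_chargeU A B : measurable A -> measurable B -> A `&` B = set0 ->
  fine (zeta (A `|` B)) = fine (zeta A) + fine (zeta B).
Proof.
move=> mA mB AB0.
have : semi_additive2 zeta.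
  move=> X Y mX mY + XY; rewrite -bigcup2inE bigcup_mkord.
  move=> /(@charge_semi_additive _ _ _ zeta (bigcup2 X Y)) ->.
  - by rewrite !(big_ord_recl, big_ord0)/= adde0.
  - by move=> [|[|[]]]//=.
  - move=> [|[|i]] [|[|j]]/= _ _ // ; rewrite ?setI0 ?set0I;
      by [rewrite XY => -[]|rewrite setIC XY => -[]|move=> -[]].
by rewrite semi_additive2E => z2; rewrite z2// fineD// fin_num_measure.
Qed.

Lemma additive_chargeDI A B : measurable A -> measurable B ->
  fine (zeta A) = fine (zeta (A `&` B)) + fine (zeta (A `\` B)).
Proof.
move=> mA mB; rewrite -additive_chargeU ?setUIDK//.
- exact: measurableI.
- exact: measurableD.
- by rewrite setDE setIACA setICr setI0.
Qed.

(** Fibres over distinct values are disjoint. With [r] the list of all values of a simple function,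
    the mass of [A] splits along its level sets. *)
Lemma additive_charge_fibers (f : T -> R) (r : seq R) A : uniq r ->
  measurable A -> (forall y, measurable (f @^-1` [set y])) ->
  fine (zeta (A `&` f @^-1` [set` r])) =
  \sum_(y <- r) fine (zeta (A `&` f @^-1` [set y])).
Proof.
move=> + mA mf; elim: r => [_|y r ih /= /andP[yr ur]].
  by rewrite set_nil preimage_set0 setI0 big_nil additive_charge0.
have mfr : measurable (f @^-1` [set` r]).
  rewrite [X in measurable X](_ : _ =
    \big[setU/set0]_(x <- r) (f @^-1` [set x])).
    exact: bigsetU_measurable.
  rewrite -bigcup_seq; apply/seteqP; split => [t rt|t [x /= xr]]/=.
    by exists (f t).
  by move=> ->.
rewrite big_cons -ih// -additive_chargeU.
- rewrite -setIUr -preimage_setU; congr (fine (zeta (_ `&` _))).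
  by apply/seteqP; split => t /=; rewrite inE => /predU1P.
- exact: measurableI.
- exact: measurableI.
- rewrite setIACA -preimage_setI; apply/seteqP; split=> // t [_ /= [->]].
  by rewrite (negPf yr).
Qed.

End additive_charge.

Lemma lebR_measurable {R : realType} (A : set (measurableTypeR R)) :
  measurable A -> (measurable : set (set (lebR R))) A.
Proof. by move=> mA; exact: sub_caratheodory. Qed.

Lemma lebR_measurable_itv {R : realType} (i : interval R) :
  (measurable : set (set (lebR R))) [set` i].
Proof. by apply: lebR_measurable; exact: measurable_itv. Qed.

Lemma Leb_set1 {R : realType} (a : R) : @Leb R [set a] = 0%E.
Proof. exact: lebesgue_measure_set1. Qed.

(** * Positive charges: integrals of nearly constant functions, and tail masses *)

Section positive_charge.
Context {R : realType}.
Variable zeta : {additive_charge set (lebR R) -> \bar R}.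
Hypothesis zba : ba zeta.
Hypothesis zpos : nonneg_charge zeta.
Implicit Types A B E : set (lebR R).
Local Notation m A := (fine (zeta A)).

Lemma charge_fine_ge0 A : measurable A -> 0 <= m A.
Proof. by move=> mA; rewrite fine_ge0//; exact: zpos. Qed.

Lemma charge_fine_le A B : measurable A -> measurable B -> A `<=` B ->
  m A <= m B.
Proof.
move=> mA mB AB; rewrite (additive_chargeDI zeta mB mA) setIidr// lerDl.
by apply: charge_fine_ge0; exact: measurableD.
Qed.

Lemma charge_null A : measurable A -> Leb (A `&` I01) = 0%E -> zeta A = 0%E.
Proof. by case: zba => _; apply. Qed.

(** Transfers statements that hold Lebesgue-a.e. to [zeta]: the part of [A] in [[0, 1]] lies in the
    null set where [P] may fail. *)
Lemma ae01_charge_null (P : R -> Prop) A : measurable A -> ae01 P ->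
  (forall t, I01 t -> P t -> ~ A t) -> zeta A = 0%E.
Proof.
move=> mA [N [mN N0 PN]] PA; apply: charge_null => //.
apply: (subset_measure0 _ _ _ N0) => //.
  by apply: measurableI => //; exact: lebR_measurable_itv.
move=> t [At It]; apply: PN => /= /(_ It) Pt; exact: (PA t).
Qed.

Import HBSimple.

(** Both sides are finite sums over the level sets of [s], so the comparison is made level by level,
    inside [E] and outside it. *)
Lemma sintegral_charge_near (s : {sfun lebR R >-> R}) E c e :
  measurable E -> ae01 (fun t => `|s t - ((fun=> c) \_ E) t| <= e) ->
  exists2 v, sintegral zeta s = v%:E & `|v - c * m E| <= e * m setT.
Proof.
move=> mE aes.
have ms y : measurable (s @^-1` [set y]) by exact: measurable_sfunP.
have fs : finite_set (range s) by exact: fimfunP.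
pose r := enum_fset (fset_set (range s)).
have rT : s @^-1` [set` r] = setT.
  by apply/seteqP; split=> // t _ /=; rewrite in_fset_set// inE; exists t.
have mEr A : measurable A ->
    m A = \sum_(y <- r) m (A `&` s @^-1` [set y]).
  move=> mA; rewrite -additive_charge_fibers ?rT ?setIT//.
  exact: fset_uniq.
exists (\sum_(y <- r) y * m (s @^-1` [set y])).
  (* [sintegral] sums over all reals; a value outside the range has an empty fibre and contributes
     0. *)
  rewrite /sintegral -(fsbig_widen (range s) setT)//=; last first.
    by move=> y [_ Nsy] /=; rewrite preimage10// additive_charge0 mule0.
  rewrite fsbig_finite//= -sumEFin; apply: eq_bigr => y _.
  by rewrite EFinM fineK// fin_num_measure.
rewrite (mEr _ mE) (mEr setT)// !mulr_sumr -sumrB.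
apply: (le_trans (ler_norm_sum _ _ _)); apply: ler_sum => y _.
rewrite setTI.
(* Either [|y - b| <= e], or the a.e. bound fails at every point of [B], so [B] has zero charge. *)
have key B b : measurable B -> (forall t, B t -> s t = y) ->
    (forall t, B t -> ((fun=> c) \_ E) t = b) ->
    `|y - b| * m B <= e * m B.
  move=> mB sB cB; have [ybe|eyb] := leP `|y - b| e.
    by rewrite ler_wpM2r// charge_fine_ge0.
  rewrite (@ae01_charge_null _ B mB aes) ?mulr0// => t _ + Bt.
  by rewrite (sB t Bt) (cB t Bt) leNgt eyb.
have mI := measurableI _ _ (ms y) mE.
have mD := measurableD (ms y) mE.
(* The fibre is cut by [E]: [key] is applied with [b = c] inside [E] and with [b = 0] outside. *)
rewrite (additive_chargeDI zeta (ms y) mE) (setIC E).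
rewrite mulrDr addrAC -mulrBl mulrDr.
apply: (le_trans (ler_normD _ _)); apply: lerD; rewrite normrM.
  rewrite (ger0_norm (charge_fine_ge0 mI)); apply: key => //.
    by move=> t [].
  by move=> t [_ Et]; rewrite patchE mem_set.
rewrite (ger0_norm (charge_fine_ge0 mD)).
have := key _ 0 mD; rewrite subr0; apply=> //.
  by move=> t [].
by move=> t [_ Et]; rewrite patchE memNset.
Qed.

(** One [e] is the distance from the approximating [s j] to [k \_ E], the other that from [k] to [c]
    on [E]. The closed bound then passes to the limit in [j]. *)
Lemma charge_integral_near (k : R -> R) E v c e : measurable E -> 0 < e ->
  ae01 (fun t => E t -> `|k t - c| < e) ->
  is_charge_integral zeta E k v -> `|v - c * m E| <= 2 * e * m setT.
Proof.
move=> mE e0 kc [s [sk /fine_cvgP[sfin scvg]]].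
suff near_s : \forall j \near \oo,
    `|fine (sintegral zeta (s j)) - c * m E| <= 2 * e * m setT.
  have cs : `|fine (sintegral zeta (s j)) - c * m E| @[j --> \oo] -->
      `|v - c * m E|.
    by apply: cvg_norm; apply: cvgB => //; exact: cvg_cst.
  rewrite -(cvg_lim (@Rhausdorff R) cs); apply: limr_le => //.
  by apply/cvg_ex; exists (`|v - c * m E|).
near=> j.
have [|w -> //=] := @sintegral_charge_near (s j) E c (2 * e) mE.
have sj : ae01 (fun t => `|s j t - (k \_ E) t| < e) by near: j; exact: sk.
rewrite /ae01 in kc sj *; move: kc sj; apply: filterS2 => t kc sj It.
have := sj It; have := kc It; rewrite !patchE; case: ifPn => [|_ _ sje].
  rewrite inE => Et /(_ Et) ke sje.
  by rewrite mulr2n mulrDl mul1r (le_trans (ler_distD (k t) _ _))// lerD// ltW.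
by rewrite (le_trans (ltW sje))// ler_peMl ?ler1n// ltW.
Unshelve. all: by end_near. Qed.

Lemma tail_mass_le t s : t <= s -> tail_mass zeta s <= tail_mass zeta t.
Proof.
move=> ts; apply: charge_fine_le; try exact: lebR_measurable_itv.
by move=> y /=; rewrite !in_itv/= => /andP[sy ->]; rewrite (le_lt_trans ts).
Qed.

Lemma tail_mass_ge0 t : 0 <= tail_mass zeta t.
Proof. by apply: charge_fine_ge0; exact: lebR_measurable_itv. Qed.

(** Shows that the [lim] in [terminal_mass] is a genuine limit: the opposite of the tail mass is
    nondecreasing and bounded above by 0. *)
Lemma tail_mass_cvg : tail_mass zeta t @[t --> 1^'-] --> terminal_mass zeta.
Proof.
suff : cvg (- tail_mass zeta t @[t --> (1:R)^'-]).
  by move=> /is_cvgN; rewrite (_ : - _ = tail_mass zeta)//; apply/funext => t;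
    rewrite fctE opprK.
apply: nondecreasing_at_left_is_cvgr.
  by near=> x => a b _ _ ab; rewrite lerN2; exact: tail_mass_le.
by near=> x; exists 0 => _ [y _ <-]; rewrite oppr_le0; exact: tail_mass_ge0.
Unshelve. all: by end_near. Qed.

Lemma terminal_mass_ge0 : 0 <= terminal_mass zeta.
Proof.
apply: (limr_ge tail_mass_cvg); near=> t; exact: tail_mass_ge0.
Unshelve. all: by end_near. Qed.

Lemma terminal_mass_le t : t < 1 -> terminal_mass zeta <= tail_mass zeta t.
Proof.
move=> t1; apply: (limr_le tail_mass_cvg); near=> s.
by apply: tail_mass_le; near: s; exact: nbhs_left_ge.
Unshelve. all: by end_near. Qed.

(** The point 1 is Lebesgue null and so carries no charge: removing it from the tail loses no
    mass. *)
Lemma terminal_mass_le_open t : t < 1 ->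
  terminal_mass zeta <= m `]t, 1%R[%classic.
Proof.
move=> /[dup] t1 /terminal_mass_le/le_trans; apply.
have mt := @lebR_measurable_itv R `]t, 1].
have mo := @lebR_measurable_itv R `]t, 1[.
rewrite /tail_mass (additive_chargeDI zeta mt mo) setIidr; last first.
  by move=> y /=; rewrite !in_itv/= => /andP[-> /ltW].
rewrite [X in _ + fine X]charge_null ?addr0//; first exact: measurableD.
apply: (subset_measure0 _ _ _ (@Leb_set1 R 1)).
- by apply: measurableI; [exact: measurableD|exact: lebR_measurable_itv].
- exact: (@lebR_measurable R _ (measurable_set1 1)).
- move=> y [[/=]]; rewrite !in_itv/= => /andP[-> y1] /= /negP.
  by rewrite -leNgt => y1' _; apply/eqP; rewrite eq_le y1.
Qed.

End positive_charge.

(** * Left limits from countable additivity *)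

(** Continuity from above along the intervals [F k], which decrease to [[set a]]; monotonicity of
    [mu] carries the limit from this sequence to all [t] near [a] on the left. *)
Lemma finite_measure_itv_cvg {R : realType}
    (mu : {finite_measure set (measurableTypeR R) -> \bar R}) (a : R) :
  fine (mu `]t, a]%classic) @[t --> a^'-] --> fine (mu [set a]).
Proof.
have muF (A : set (measurableTypeR R)) : measurable A -> mu A \is a fin_num.
  exact: fin_num_measure.
have mI (i : interval R) : measurable ([set` i] : set (measurableTypeR R)).
  exact: measurable_itv.
have ma : measurable ([set a] : set (measurableTypeR R)).
  exact: measurable_set1.
pose F (k : nat) : set (measurableTypeR R) := `]a - k.+1%:R^-1, a]%classic.
have mF k : measurable (F k) by exact: mI.
have Fa : \bigcap_k F k = [set a].
  apply/seteqP; split => [y Fy|_ -> k _] /=; last first.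
    by rewrite /F/= in_itv/= lexx andbT ltrBlDr ltrDl invr_gt0.
  have := Fy 0%N Logic.I; rewrite /F/= in_itv/= => /andP[_ ya].
  apply/eqP; rewrite eq_le ya leNgt; apply/negP => ylta.
  have [k kay] := ltr_add_invr ylta.
  have := Fy k Logic.I; rewrite /F/= in_itv/= => /andP[+ _].
  by rewrite ltrBlDr ltNge (ltW kay).
have niF : nonincreasing_seq F.
  move=> i j ij; apply/subsetPset => y; rewrite /F/= !in_itv/= => /andP[+ ->].
  rewrite andbT; apply: le_lt_trans; rewrite lerB// lef_pV2 ?posrE//.
  by rewrite ler_nat.
have cF : (mu \o F) k @[k --> \oo] --> (fine (mu [set a]))%:E.
  rewrite fineK ?muF//.
  rewrite -Fa; apply: nonincreasing_cvg_mu => //.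
  - by rewrite -ge0_fin_numE// muF.
  - by rewrite Fa.
have /fine_cvgP[_ /cvgrPdist_lt {}cF] := cF.
apply/cvgrPdist_lt => e e0.
have [k _ /(_ k (leqnn k))/= Fke] := cF e e0.
near=> t.
have ta : t < a by near: t; exact: nbhs_left_lt.
have mono (A B : set (measurableTypeR R)) : measurable A -> measurable B ->
    A `<=` B -> fine (mu A) <= fine (mu B).
  by move=> mA mB AB; rewrite fine_le ?muF// le_measure ?inE.
have le1 : fine (mu [set a]) <= fine (mu `]t, a]%classic).
  apply: mono => //.
  by move=> y ->; rewrite /= in_itv/= ta lexx.
apply: le_lt_trans Fke; rewrite ler0_norm ?subr_le0// opprB.
rewrite distrC; apply: (le_trans _ (ler_norm _)); rewrite lerD2r.
apply: mono => //.
move=> y /=; rewrite /F/= !in_itv/= => /andP[ty ->]; rewrite andbT.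
apply: le_lt_trans ty; near: t; apply: nbhs_left_ge.
by rewrite ltrBlDr ltrDl invr_gt0.
Unshelve. all: by end_near. Qed.

(** A signed charge is not monotone, so the limit is taken on each part of its Jordan
    decomposition. *)
Lemma charge_itv_cvg0 {R : realType}
    (nu : {charge set (measurableTypeR R) -> \bar R}) (a : R) :
  nu [set a] = 0%E -> fine (nu `]t, a]%classic) @[t --> a^'-] --> (0 : R).
Proof.
move=> nua.
have [Q [N PN]] := Hahn_decomposition nu.
have ma : measurable ([set a] : set (measurableTypeR R)).
  exact: measurable_set1.
(* The Jordan parts are, up to sign, [nu] restricted to [Q] and to [N]; both vanish at [[set a]]
   because [nu] vanishes on each subset of this singleton. *)
have nuaI A : nu ([set a] `&` A) = 0%E.
  have [Aa|Aa] := pselect (A a).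
    by rewrite setIidl// => _ ->.
  by rewrite (_ : _ `&` _ = set0) ?charge0//; apply/seteqP; split=> // y [->].
have pos_a : jordan_pos PN [set a] = 0%E.
  by rewrite jordan_posE cjordan_posE /crestr0 mem_set// /crestr nuaI.
have neg_a : jordan_neg PN [set a] = 0%E.
  rewrite jordan_negE cjordan_negE /crestr0 mem_set// /crestr nuaI.
  by rewrite oppe0.
have cp := @finite_measure_itv_cvg R (jordan_pos PN) a.
have cn := @finite_measure_itv_cvg R (jordan_neg PN) a.
have h := cvgB cp cn; rewrite /= pos_a neg_a subr0 in h.
apply: (cvg_trans _ (h _)); apply: near_eq_cvg.
near=> t; have mt : measurable (`]t, a]%classic : set (measurableTypeR R)).
  exact: measurable_itv.
rewrite fctE (jordan_decomp PN mt) /cadd/= cscaleN1 fineB//.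
  by rewrite fin_num_measure.
by rewrite fin_num_measure.
Unshelve. all: by end_near. Qed.

(** The increment of [lam + beta] over []t, 1]] is the mass of that interval under [dlam + dbeta].
    It tends to the mass of [[set 1]], which the equation on this null set forces to be 0. *)
Lemma differential_left_limit {R : realType} (lam beta : R -> R)
    (h : R -> \bar R)
    (dlam dbeta : {charge set (measurableTypeR R) -> \bar R}) :
  is_differential lam dlam -> is_differential beta dbeta ->
  (forall A : set (measurableTypeR R), measurable A -> A `<=` `[0, 1] ->
    (- dlam A = \int[@Leb R]_(t in A) h t + dbeta A)%E) ->
  lam t + beta t @[t --> 1^'-] --> lam 1 + beta 1.
Proof.
move=> Dlam Dbeta dE; pose nu := cadd dlam dbeta.
have m1 : measurable ([set 1] : set (measurableTypeR R)).
  exact: measurable_set1.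
have nu1 : nu [set 1] = 0%E.
  have /(dE _ m1) : [set (1:R)] `<=` `[0, 1].
    by move=> _ ->; rewrite /= in_itv/= ler01 lexx.
  (* [h] is an arbitrary function: on [[set 1]] it is replaced by the constant [h 1], whose integral
     over a null set is 0. *)
  rewrite (_ : integral _ _ _ = 0%E) ?add0e; last first.
    rewrite (eq_integral (cst (h 1)))/=; last by move=> t; rewrite inE => ->.
    rewrite integral_cst ?Leb_set1 ?mule0//.
    exact: lebR_measurable m1.
  by rewrite /nu /cadd/= => <-; rewrite subee// fin_num_measure.
have nuE t : 0 < t < 1 ->
    fine (nu `]t, 1]%classic) = lam 1 + beta 1 - (lam t + beta t).
  move=> /andP[t0 t1].
  (* [is_differential] prescribes only the masses of intervals starting at 0, so the tail is written
     as a difference of two of them. *)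
  have tailE f (df : {charge set (measurableTypeR R) -> \bar R}) :
      is_differential f df -> df `]t, 1]%classic = (f 1 - f t)%:E.
    move=> Df.
    have -> : `]t, 1]%classic = `[0, 1]%classic `\` `[0, t]%classic.
      apply/seteqP; split => y /=; rewrite !in_itv/=.
        by move=> /andP[ty ->]; rewrite (ltW (lt_trans t0 ty))/= leNgt ty.
      by move=> [/andP[-> ->]]/= /negP; rewrite -ltNge => ->.
    have mI (i : interval R) : measurable ([set` i] : set (measurableTypeR R)).
      exact: measurable_itv.
    rewrite chargeD// setIidr; last first.
      by move=> y /=; rewrite !in_itv/= => /andP[->] /le_trans ->//; exact: ltW.
    by rewrite !Df ?ltr01 ?lexx ?t0 ?(ltW t1)// -EFinB; congr EFin; ring.
  by rewrite /nu /cadd/= (tailE lam)// (tailE beta)//=; ring.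
have /cvgrPdist_lt nu_cvg := charge_itv_cvg0 nu1.
apply/cvgrPdist_lt => e /nu_cvg nu_e; near=> t.
have t01 : 0 < t < 1.
  by apply/andP; split; near: t; [exact: nbhs_left_gt|exact: nbhs_left_lt].
rewrite -(nuE _ t01) -normrN -sub0r; near: t; exact: nu_e.
Unshelve. all: by end_near. Qed.

(** * Left limit of the charge integrals *)

(** The mass of [E = [t + 1/(j+1), 1]] lies between [z1] and the tail mass at [t], while [k] is
    within [eta] of [alpha] a.e. on [E]. Both bounds hold for all large [j], hence survive the limit
    defining [b t]. *)
Lemma charge_integral_left_limit {R : realType}
    (zeta : {additive_charge set (lebR R) -> \bar R}) (k b : R -> R)
    (alpha : R) :
  ba zeta -> nonneg_charge zeta -> ess_limit k 1 alpha ->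
  (forall t, 0 < t < 1 -> exists2 I : nat -> R,
     forall j, is_charge_integral zeta `[t + j.+1%:R^-1, 1] k (I j) &
     I j @[j --> \oo] --> b t) ->
  b t @[t --> 1^'-] --> terminal_mass zeta * alpha.
Proof.
move=> zba zpos kalpha bI; set z1 := terminal_mass zeta.
pose M := fine (zeta setT).
have M0 : 0 <= M by exact: charge_fine_ge0.
have M1 : 0 < M + 1 by rewrite ltr_wpDl.
have a1 : 0 < `|alpha| + 1 by rewrite ltr_wpDl.
apply/cvgrPdist_le => e e0.
(* Chosen so that the error [2 * eta * M] of the integral is at most [e / 2]. Here [M + 1], like
   [|alpha| + 1] below, keeps the denominator positive. *)
pose eta := e / (4 * (M + 1)).
have eta0 : 0 < eta by rewrite divr_gt0// mulr_gt0.
have [V /nbhs_ballP[r /= r0 rV] kV] := kalpha _ eta0.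
have /cvgrPdist_le tail_cvg := tail_mass_cvg zpos.
have e'0 : 0 < e / (2 * (`|alpha| + 1)) by rewrite divr_gt0// mulr_gt0.
near=> t.
have t0 : 0 < t by near: t; exact: nbhs_left_gt.
have t1 : t < 1 by near: t; exact: nbhs_left_lt.
have rt : 1 - r < t by near: t; apply: nbhs_left_gt; rewrite ltrBlDr ltrDl.
have tail_t : `|z1 - tail_mass zeta t| <= e / (2 * (`|alpha| + 1)).
  by near: t; exact: tail_cvg.
have [|I Ik Ib] := bI t; first by rewrite t0.
have cI : `|z1 * alpha - I j| @[j --> \oo] --> `|z1 * alpha - b t|.
  by apply: cvg_norm; apply: cvgB => //; exact: cvg_cst.
rewrite -(cvg_lim (@Rhausdorff R) cI); apply: limr_le.
  by apply/cvg_ex; exists (`|z1 * alpha - b t|).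
(* From [j0] on the left end of [E] is below 1, as the lower bound [z1] on its mass requires. *)
have [j0 tj0] := ltr_add_invr t1.
exists j0 => // j /= j0j.
set E := `[t + j.+1%:R^-1, 1]%classic.
have mE : (measurable : set (set (lebR R))) E by exact: lebR_measurable_itv.
have tj : t + j.+1%:R^-1 < 1.
  apply: le_lt_trans tj0; rewrite lerD2l lef_pV2 ?posrE//.
  by rewrite ler_nat.
have jpos : 0 < j.+1%:R^-1 :> R by rewrite invr_gt0.
have kE : ae01 (fun s => E s -> `|k s - alpha| < eta).
  rewrite /ae01 in kV *; move: kV; apply: filterS => s kV Is.
  rewrite /E/= in_itv/= => /andP[ts s1].
  apply: kV => //; apply: rV; rewrite /ball/= ger0_norm ?subr_ge0//.
  rewrite ltrBlDr -ltrBlDl (lt_le_trans rt)// (le_trans _ ts)// lerDl.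
  exact: ltW.
have := charge_integral_near zba zpos mE eta0 kE (Ik j); rewrite -/M => Ij.
have z1E : z1 <= fine (zeta E).
  apply: (le_trans (terminal_mass_le zpos tj)).
  apply: charge_fine_le => //; first exact: lebR_measurable_itv.
  by move=> y; rewrite /E/= !in_itv/= => /andP[/ltW -> ->].
have Et : fine (zeta E) <= tail_mass zeta t.
  apply: charge_fine_le => //; first exact: lebR_measurable_itv.
  move=> y; rewrite /E/= !in_itv/= => /andP[ty ->]; rewrite andbT.
  by apply: lt_le_trans ty; rewrite ltrDl.
have -> : z1 * alpha - I j =
    (z1 - fine (zeta E)) * alpha - (I j - alpha * fine (zeta E)) by ring.
apply: (le_trans (ler_normB _ _)); rewrite normrM.
have -> : e = e / 2 + e / 2 by lra.
apply: lerD; last first.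
  apply: (le_trans Ij); rewrite /eta.
  have -> : 2 * (e / (4 * (M + 1))) * M = e / 2 * (M / (M + 1)).
    by field; exact: lt0r_neq0.
  by rewrite ler_piMr ?divr_ge0 ?(ltW e0)// ler_pdivrMr// mul1r lerDl.
have zE : `|z1 - fine (zeta E)| <= e / (2 * (`|alpha| + 1)).
  apply: le_trans tail_t; rewrite !ler0_norm ?subr_le0 ?(le_trans z1E)//.
  by rewrite lerN2 lerD2l lerN2.
apply: (le_trans (ler_wpM2r _ zE)) => //.
have -> : e / (2 * (`|alpha| + 1)) * `|alpha| =
    e / 2 * (`|alpha| / (`|alpha| + 1)).
  by field; exact: lt0r_neq0.
by rewrite ler_piMr ?divr_ge0 ?(ltW e0)// ler_pdivrMr// mul1r lerDl.
Unshelve. all: by end_near. Qed.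

(** * Divergence of an integral against an integrable bound *)

Section lower_integral.
Local Open Scope ereal_scope.
Import HBNNSimple.

(* The library integral of a nonnegative function is a supremum over simple
   functions below it, so that no measurability of [f] is required. *)
Lemma ge0_ae_le_integral_lower d (T : measurableType d) (R : realType)
    (mu : {measure set T -> \bar R}) (D : set T) (f g : T -> \bar R) :
  measurable D -> measurable_fun D g ->
  (forall t, D t -> 0 <= f t) -> (forall t, D t -> 0 <= g t) ->
  {ae mu, forall t, D t -> f t <= g t} ->
  \int[mu]_(t in D) f t <= \int[mu]_(t in D) g t.
Proof.
move=> mD mg f0 g0 fg; rewrite integral_mkcond [leRHS]integral_mkcond.
rewrite ge0_integralTE; last by move=> t; exact: erestrict_ge0.
apply: ge_ereal_sup => _ [h /= hf <-]; rewrite -integralT_nnsfun.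
apply: ae_ge0_le_integral => //.
- by move=> t _; rewrite lee_fin.
- by apply/measurable_EFinP; exact: measurable_funPT.
- by move=> t _; exact: erestrict_ge0.
- exact/(measurable_restrictT _ mD).1.
apply: filterS fg => t fg _; apply: (le_trans (hf t)); rewrite !patchE.
by case: ifPn => // /[!inE]; exact: fg.
Qed.

End lower_integral.

(** To be used with [w] an entry of [fu^T lam + lam0 Lu^T] and [G] the norm of [gu]. A nonzero
    [alpha] would give [1 / G <= |z| / e] a.e. near 1. *)
Lemma ess_limit_eq0 {R : realType} (w z G : R -> R) (alpha delta0 : R) :
  0 < delta0 < 1 ->
  (forall delta, 0 < delta <= delta0 ->
    (\int[@Leb R]_(t in `[(1 - delta)%R, 1%R]%classic)
      ((G t)%:E)^-1 = +oo)%E) ->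
  (forall t, 0 <= G t) ->
  (@Leb R).-integrable I01 (fun t : lebR R => (z t)%:E) ->
  ae01 (fun t => `|w t| <= `|z t| * G t) ->
  ess_limit w 1 alpha -> alpha = 0.
Proof.
move=> /andP[d0 d1] Goo G0 zint wzG walpha.
apply/eqP; apply: contrapT => /negP alpha0.
pose e := `|alpha| / 2.
have e0 : 0 < e by rewrite divr_gt0// normr_gt0.
have [V /nbhs_ballP[r /= r0 rV] wV] := walpha _ e0.
(* The bound [delta0 < 1] keeps [D] inside [[0, 1]]; halving [r] keeps its left end in the open
   ball. *)
pose delta := Num.min delta0 (r / 2).
have delta_gt0 : 0 < delta by rewrite lt_min d0 divr_gt0.
have /Goo : 0 < delta <= delta0 by rewrite delta_gt0 ge_min lexx.
pose D : set (lebR R) := `[1 - delta, 1]%classic.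
have mD : measurable D by exact: lebR_measurable_itv.
have DI : D `<=` I01.
  move=> t; rewrite /D/I01/= !in_itv/= => /andP[dt ->]; rewrite andbT.
  apply: le_trans dt; rewrite subr_ge0 (@le_trans _ _ delta0) ?ge_min ?lexx//.
  exact: ltW.
have zD : (@Leb R).-integrable D (fun t : lebR R => (e^-1)%:E * (z t)%:E)%E.
  by apply: integrableZl => //; apply: integrableS zint => //;
    exact: lebR_measurable_itv.
have /integrableP[mzD zDoo] := zD.
suff : (\int[@Leb R]_(t in D) ((G t)%:E)^-1 <=
        \int[@Leb R]_(t in D) `|(e^-1)%:E * (z t)%:E|)%E.
  by move=> /le_lt_trans /(_ zDoo) /[swap] ->; rewrite ltxx.
apply: ge0_ae_le_integral_lower => //.
- exact: measurableT_comp.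
- by move=> t _; rewrite inve_ge0 lee_fin.
rewrite /ae01 in wV wzG; move: wV wzG; apply: filterS2 => t wV wzG Dt.
have It := DI _ Dt.
have Vt : V t.
  move: Dt; rewrite /D/= in_itv/= => /andP[dt t1].
  apply: rV; rewrite /ball/= ger0_norm ?subr_ge0//.
  rewrite ltrBlDl -ltrBlDr; apply: lt_le_trans dt.
  rewrite ltrD2l ltrN2 gt_min; apply/orP; right.
  by rewrite ltr_pdivrMr// ltr_pMr// ltr1n.
have ewt : e <= `|w t|.
  have := ltW (wV It Vt); have := lerB_dist alpha (w t).
  rewrite distrC /e; lra.
have eG : e <= `|z t| * G t by apply: (le_trans ewt); exact: wzG.
(* This excludes the value [+oo] that the inverse takes at 0. *)
have Gt : 0 < G t.
  rewrite lt_neqAle G0 andbT eq_sym; apply: contraTneq eG => ->.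
  by rewrite mulr0 -ltNge.
rewrite inver gt_eqF// -EFinM abse_EFin lee_fin normrM gtr0_norm ?invr_gt0//.
by rewrite -[leLHS]mul1r ler_pdivrMr// -mulrA mulrC ler_pdivlMr// mul1r.
Qed.

(** * Matrix entries, and essential limits as limits along a filter *)

Lemma entry_le_enorm {R : realType} (p q : nat) (A : 'M[R]_(p, q)) i j :
  `|A i j| <= enorm A.
Proof.
have sq_ge0 : forall k l, 0 <= A k l ^+ 2 by move=> k l; exact: sqr_ge0.
rewrite -sqrtr_sqr ler_wsqrtr// (bigD1 i)//= (bigD1 j)//= -addrA lerDl.
by rewrite addr_ge0 ?sumr_ge0// => k _; rewrite sumr_ge0.
Qed.

Lemma cvg_entries {R : realType} (F : set_system R) {FF : Filter F} (p q : nat)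
    (f : R -> 'M[R]_(p, q)) (A : 'M[R]_(p, q)) :
  (forall i j, f t i j @[t --> F] --> A i j) -> f t @[t --> F] --> A.
Proof.
move=> fA; apply/cvg_ballP => e e0.
have H i : \forall t \near F, forall j, ball (A i j) e (f t i j).
  by apply: filter_forall => j; move/cvg_ballP : (fA i j); exact.
near=> t; split => // i j; move: j; move: i; near: t.
exact: filter_forall.
Unshelve. all: by end_near. Qed.

(* [k @ ess_nbhs t --> alpha] is [ess_limit k t alpha]. *)
Definition ess_nbhs {R : realType} (t : R) : set_system R :=
  [set A | exists2 V, nbhs t V & ae01 (fun s => V s -> A s)].

(** Makes the calculus of limits of sums and products available for essential limits. *)
Lemma ess_nbhs_filter {R : realType} (t : R) : Filter (ess_nbhs t).
Proof.
split.
- by exists setT; [exact: filterT|exact: aeW].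
- move=> A B [V tV VA] [W tW WB]; exists (V `&` W); first exact: filterI.
  rewrite /ae01 in VA WB *; move: VA WB; apply: filterS2 => s VA WB Is [Vs Ws].
  by split; [exact: VA|exact: WB].
- move=> A B AB [V tV VA]; exists V => //.
  by rewrite /ae01 in VA *; apply: filterS VA => s VA Is Vs;
    apply: AB; exact: VA.
Qed.
#[local] Existing Instance ess_nbhs_filter.

Lemma ess_limitP {R : realType} (k : R -> R) (t alpha : R) :
  ess_limit k t alpha <-> k s @[s --> ess_nbhs t] --> alpha.
Proof.
split => [kalpha|/cvgrPdist_lt kalpha e e0].
  apply/cvgrPdist_lt => e e0; have [V tV kV] := kalpha e e0; exists V => //.
  rewrite /ae01 in kV *; apply: filterS kV => s + Is Vs => /(_ Is Vs).
  by rewrite distrC.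
have [V tV kV] := kalpha e e0; exists V => //.
rewrite /ae01 in kV *; apply: filterS kV => s + Is Vs => /(_ Is Vs).
by rewrite distrC.
Qed.

(** Within [[0, 1]], a neighbourhood of 1 is a left neighbourhood together with the null set
    [[set 1]]. *)
Lemma ess_nbhs_at_left {R : realType} (U : topologicalType) (f : R -> U)
    (l : U) :
  f t @[t --> 1^'-] --> l -> f t @[t --> ess_nbhs 1] --> l.
Proof.
move=> fl A /fl; rewrite /= => -[r /= r0 rA]; exists (ball (1 : R) r).
  exact: nbhsx_ballx.
exists [set 1]; split => [||s /= sA].
- exact: (@lebR_measurable R _ (measurable_set1 1)).
- exact: Leb_set1.
- apply: contrapT => s1; apply: sA; rewrite /I01/= in_itv/= => /andP[_ s1'] sr.
  by apply: rA => //; rewrite lt_neqAle s1' andbT; apply/eqP.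
Qed.

(** * Costate limit, terminal balance and its consequences *)

Theorem proposition3p12 (R : realType) (n m : nat) (P : problem R n m)
  (x : R -> 'cV[R]_n) (u : R -> 'cV[R]_m)
  (hmin : weak_local_minimizer P x u)
  (delta0 : R) (hdelta0 : 0 < delta0 < 1)
  (hint : forall delta : R, 0 < delta <= delta0 ->
     (\int[@Leb R]_(t in `[(1 - delta)%R, 1%R]%classic)
        ((enorm (gu P x u t))%:E)^-1 = +oo)%E)
  (fu1 : 'M[R]_(n, m)) (Lu1 : 'rV[R]_m) (gx1 : 'rV[R]_n)
  (hfu1 : forall i j, ess_limit (fun t => fu P x u t i j) 1 (fu1 i j))
  (hLu1 : forall j, ess_limit (fun t => Lu P x u t 0 j) 1 (Lu1 0 j))
  (hgx1 : forall i, ess_limit (fun t => gx P x u t 0 i) 1 (gx1 0 i))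
  (lam beta : R -> 'cV[R]_n) (lam0 : R) (z : R -> R)
  (zeta : {additive_charge set (lebR R) -> \bar R})
  (hmult : multiplier_tuple P x u lam beta lam0 z zeta) :
  let zeta1 := terminal_mass zeta in
  [/\ tail_mass zeta t @[t --> 1^'-] --> zeta1 /\
        0 <= zeta1 <= fine (zeta I01),
      lam t @[t --> 1^'-] --> zeta1 *: gx1^T,
      lam0 *: Lu1^T + zeta1 *: (fu1^T *m gx1^T) = 0,
      (* (i) *)
      Lu1 <> 0 ->
      (forall c : R, 0 < c -> Lu1^T <> - (c *: (fu1^T *m gx1^T))) ->
      lam0 = 0 /\ (fu1^T *m gx1^T <> 0 -> zeta1 = 0) &
      (* (ii) *)
      forall c0 : R, 0 < c0 -> Lu1^T = - (c0 *: (fu1^T *m gx1^T)) ->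
      fu1^T *m gx1^T <> 0 ->
      zeta1 = c0 * lam0 /\
      (0 < lam0 ->
         0 < c0 * lam0 /\
         forall e : R, 0 < e ->
           ((c0 * lam0)%:E <= zeta (`](1 - e)%R, 1%R[%classic `&` I01))%E)].
Proof.
move=> zeta1; set v := fu1^T *m gx1^T.
have [lam0_ge0 z_L1 _ zba zpos _ _ _ _ _ _ lam1 beta1 costate _ beta_in
  stat _] := hmult.
have zeta1_ge0 : 0 <= zeta1 by exact: terminal_mass_ge0.
have lam_entry i : lam t i 0 @[t --> 1^'-] --> zeta1 * gx1 0 i.
  have beta_cvg : - beta t i 0 @[t --> 1^'-] --> zeta1 * gx1 0 i.
    apply: charge_integral_left_limit (hgx1 i) _ => // t t01; exact: beta_in.
  have [dlam [dbeta [Dlam Dbeta dE]]] := costate i.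
  have sum_cvg := cvgD (differential_left_limit Dlam Dbeta dE) beta_cvg.
  rewrite lam1 beta1 !mxE addr0 add0r in sum_cvg.
  apply: (cvg_trans _ (sum_cvg _)).
  by apply: near_eq_cvg; near=> t; rewrite fctE addrK.
have lam_cvg : lam t @[t --> 1^'-] --> zeta1 *: gx1^T.
  by apply: cvg_entries => i j; rewrite ord1 !mxE; exact: lam_entry.
have balance : lam0 *: Lu1^T + zeta1 *: v = 0.
  apply/matrixP => j k; rewrite ord1.
  pose w t := ((fu P x u t)^T *m lam t + lam0 *: (Lu P x u t)^T) j 0.
  have : ess_limit w 1 ((lam0 *: Lu1^T + zeta1 *: v) j 0).
    have -> : w = fun t =>
        \sum_i fu P x u t i j * lam t i 0 + lam0 * Lu P x u t 0 j.
      apply/funext => t; rewrite /w !mxE; congr (_ + _).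
      by apply: eq_bigr => i _; rewrite !mxE.
    have -> : (lam0 *: Lu1^T + zeta1 *: v) j 0 =
        \sum_i fu1 i j * (zeta1 * gx1 0 i) + lam0 * Lu1 0 j.
      rewrite !mxE addrC mulr_sumr; congr (_ + _).
      by apply: eq_bigr => i _; rewrite !mxE mulrCA.
    (* [fu] and [Lu] have essential limits and [lam] a true left limit; all are read along the one
       filter [ess_nbhs 1]. *)
    apply/ess_limitP; apply: cvgD; last first.
      by apply: cvgM; [exact: cvg_cst|exact: (ess_limitP _ _ _).1].
    apply: (cvg_big add_continuous) => i _.
    apply: cvgM; first exact: (ess_limitP _ _ _).1.
    exact: ess_nbhs_at_left.
  rewrite [RHS]mxE; apply: (ess_limit_eq0 hdelta0 hint _ z_L1).
    by move=> t; exact: sqrtr_ge0.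
  rewrite /ae01 in stat *; apply: filterS stat => t stat It.
  (* Entry [j] of stationarity says that [w t] is the opposite of [z t] times an entry of [gu],
     which its Euclidean norm bounds. *)
  have /matrixP/(_ j 0) := stat It.
  rewrite mxE -/(w t) [X in _ + X]mxE [X in _ + _ * X]mxE [RHS]mxE.
  move/eqP; rewrite addr_eq0 => /eqP ->; rewrite normrN normrM ler_wpM2l//.
  exact: entry_le_enorm.
split => //.
- split; first exact: tail_mass_cvg.
  rewrite zeta1_ge0/=; apply: (le_trans (terminal_mass_le zpos ltr01)).
  apply: charge_fine_le => //; try exact: lebR_measurable_itv.
  by move=> t; rewrite /I01/= !in_itv/= => /andP[/ltW -> ->].
- move=> Lu1_neq0 Lu1_neq.
  have lam0_eq0 : lam0 = 0.
    apply/eqP; rewrite eq_le lam0_ge0 andbT leNgt; apply/negP => lam0_gt0.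
    (* The balance divided by [lam0]: [zeta1 = 0] would make [Lu1] vanish, and [zeta1 > 0] is
       excluded by the assumption at [c = zeta1 / lam0]. *)
    have LuE : Lu1^T = - ((zeta1 / lam0) *: v).
      apply: (scalerI (lt0r_neq0 lam0_gt0)).
      rewrite scalerN scalerA mulrC divfK ?lt0r_neq0//.
      by apply/eqP; rewrite -addr_eq0 balance.
    have [z0|z0] := eqVneq zeta1 0.
      apply: Lu1_neq0; apply: trmx_inj.
      by rewrite LuE z0 mul0r scale0r oppr0 trmx0.
    by apply: (Lu1_neq (zeta1 / lam0)) => //; rewrite divr_gt0// lt0r z0.
  split => // /eqP v0; move/eqP: balance.
  by rewrite lam0_eq0 scale0r add0r scaler_eq0 (negPf v0) orbF => /eqP.
- move=> c0 c0_gt0 LuE /eqP v0.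
  have zeta1E : zeta1 = c0 * lam0.
    move/eqP: balance; rewrite LuE scalerN scalerA addrC -scalerBl.
    by rewrite scaler_eq0 (negPf v0) orbF subr_eq0 mulrC => /eqP.
  split=> // lam0_gt0; split; first exact: mulr_gt0.
  move=> e e0; rewrite -zeta1E.
  (* The maximum with 0 keeps []t, 1[] inside [[0, 1]] when [e > 1]. *)
  pose t := Num.max (1 - e) 0.
  have t1 : t < 1 by rewrite gt_max ltr01 andbT ltrBlDr ltrDl.
  have mA : (measurable : set (set (lebR R))) (`]1 - e, 1[%classic `&` I01).
    by apply: measurableI; exact: lebR_measurable_itv.
  rewrite -(fineK (fin_num_measure zeta _ mA)) lee_fin.
  apply: (le_trans (terminal_mass_le_open zba zpos t1)).
  apply: charge_fine_le => //; first exact: lebR_measurable_itv.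
  move=> s; rewrite /I01/= !in_itv/= gt_max => /andP[/andP[-> s0] s1].
  by rewrite s1 !ltW.
Unshelve. all: by end_near. Qed.
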